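(* Let $v \in \mathbb{N}$ and let $(X_i,\kappa_i)$ be a finite (nonempty) digital image for $1 \le i \le v$. Let $X = \prod_{i=1}^v X_i$. If for some $j \in \{1,\dots,v\}$ the digital image $(X_j,\kappa_j)$ is reducible, then $(X, NP_v(\kappa_1,\ldots,\kappa_v))$ is reducible.
   Context: A digital image is a pair $(X,\kappa)$ where $X \subset \mathbb{Z}^n$ for some $n \in \mathbb{N}$ and $\kappa$ is an adjacency relation (a symmetric, irreflexive binary relation) on $X$; thus it is a simple graph. Write $x \leftrightarrow_\kappa y$ if $x,y$ are $\kappa$-adjacent. A function $f:(X,\kappa)\to(Y,\lambda)$ is $(\kappa,\lambda)$-continuous if $x \leftrightarrow_\kappa x'$ implies $f(x)=f(x')$ or $f(x)\leftrightarrow_\lambda f(x')$. Homotopy: For integers $a\le b$, $[a,b]_{\mathbb{Z}}=\{z\in\mathbb{Z} : a\le z\le b\}$, where $z,z'$ are adjacent iff $|z-z'|=1$. Continuous functions $f,g:(X,\kappa)\to(Y,\lambda)$ are homotopic if there are a positive integer $m$ and $F:X\times[0,m]_{\mathbb{Z}}\to Y$ such that $F(x,0)=f(x)$ and $F(x,m)=g(x)$ for all $x\in X$; for each $x\in X$ the map $t\mapsto F(x,t)$ is continuous (i.e., $F(x,t)$ and $F(x,t+1)$ are equal or adjacent for $0\le t<m$); and for each $t$ the map $x\mapsto F(x,t)$ is $(\kappa,\lambda)$-continuous. Digital images $(X,\kappa)$ and $(Y,\lambda)$ are homotopy equivalent if there are continuous maps $f:X\to Y$, $g:Y\to X$ with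 $g\circ f$ homotopic to $\mathrm{id}_X$ and $f\circ g$ homotopic to $\mathrm{id}_Y$. A finite digital image is reducible if it is homotopy equivalent to a digital image with fewer points; otherwise it is irreducible. Product adjacency: for distinct $x=(x_1,\dots,x_v)$ and $x'=(x_1',\dots,x_v')$ in $X=\prod_{i=1}^v X_i$, with $x_i,x_i'\in X_i$, and $1\le u\le v$, $x$ and $x'$ are $NP_u(\kappa_1,\dots,\kappa_v)$-adjacent iff for at least $1$ and at most $u$ indices $i$ we have $x_i\leftrightarrow_{\kappa_i}x_i'$, and $x_j=x_j'$ for all other indices $j$. *)

(* Defs.v *)
From HB Require Import structures.
From mathcomp Require Import all_boot all_order all_algebra.
From mathcomp Require Import boolp classical_sets cardinality.

Set Implicit Arguments.
Unset Strict Implicit.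
Unset Printing Implicit Defensive.

Local Open Scope classical_set_scope.
Local Open Scope card_scope.

Record digital_image := DigitalImage {
  dim : nat;
  points :> set 'rV[int]_dim;
  adj : rel points;
  adj_sym : symmetric adj;
  adj_irr : irreflexive adj }.
Arguments points : clear implicits.
Arguments adj {_} x y.

Definition adj_continuous (A B : Type) (a : rel A) (b : rel B) (f : A -> B) :=
  forall x x' : A, a x x' -> f x = f x' \/ b (f x) (f x').

Definition continuous_map (X Y : digital_image) (f : X -> Y) :=
  adj_continuous (@adj X) (@adj Y) f.

(* The adjacency |t - t'| = 1 on [0, m]_Z, encoded as 'I_m.+1. *)
Definition interval_adj (m : nat) : rel 'I_m.+1 :=
  fun t t' => (t.+1 == t' :> nat) || (t'.+1 == t :> nat).

Definition homotopic (X Y : digital_image) (f g : X -> Y) :=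
  [/\ continuous_map f, continuous_map g &
    exists (m : nat) (F : X -> 'I_m.+1 -> Y),
      [/\ 0 < m,
          forall x, F x ord0 = f x /\ F x ord_max = g x,
          forall x, adj_continuous (@interval_adj m) (@adj Y) (F x) &
          forall t, continuous_map (fun x => F x t)]].

Definition homotopy_equivalent (X Y : digital_image) :=
  exists (f : X -> Y) (g : Y -> X),
    [/\ continuous_map f, continuous_map g,
        homotopic (fun x => g (f x)) id & homotopic (fun y => f (g y)) id].

Definition fewer_points (Y X : digital_image) : bool :=
  (points Y #<= points X) && ~~ (points X #<= points Y).

Definition reducible (X : digital_image) :=
  finite_set (points X) /\
  exists Y : digital_image, homotopy_equivalent X Y /\ fewer_points Y X.

Section Product.
Variables (v : nat) (X : 'I_v -> digital_image).

(* The product of the Z^(n_i) is identified with Z^(n_1 + ... + n_v) by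
   concatenation of coordinates: the i-th component of x is its i-th block. *)
Definition prod_points : set 'rV[int]_(\sum_(i < v) dim (X i)) :=
  [set x | forall i, points (X i) (submxrow x i)].

Definition component (x : prod_points) (i : 'I_v) : X i :=
  exist _ (submxrow (val x) i) (mem_set (set_mem (valP x) i)).

Definition NP_adj (u : nat) : rel prod_points := fun x x' =>
  let A := [set i | adj (component x i) (component x' i)]%SET in
  [&& x != x', 1 <= #|A| <= u &
      [forall j, (j \notin A) ==> (component x j == component x' j)]].

Lemma NP_adj_sym u : symmetric (NP_adj u).
Proof.
move=> x y; rewrite /NP_adj eq_sym.
have -> : [set i | adj (component x i) (component y i)]%SET =
          [set i | adj (component y i) (component x i)]%SET.
  by apply/setP => i; rewrite !inE adj_sym.
by congr [&& _, _ & _]; apply: eq_forallb => j; rewrite [RHS]/= eq_sym.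
Qed.

Lemma NP_adj_irr u : irreflexive (NP_adj u).
Proof. by move=> x; rewrite /NP_adj eqxx. Qed.

Definition NP_product (u : nat) : digital_image :=
  DigitalImage (@NP_adj_sym u) (@NP_adj_irr u).

End Product.

(* Main.v *)
(* In the NP_v adjacency, two points of the product are equal or adjacent iff
   all their components are equal or adjacent.  So continuous maps and
   homotopies can be taken componentwise, once the homotopies of the factors
   are prolonged by constants to a common length, and a product of homotopy
   equivalences is one.  Replacing X_j by a homotopy equivalent image with
   fewer points then decreases the number of points of the product, because
   the other factors are nonempty. *)
Require Import Defs.
From mathcomp Require Import all_boot all_order all_algebra.
From mathcomp Require Import boolp classical_sets functions cardinality.

Set Implicit Arguments.
Unset Strict Implicit.
Unset Printing Implicit Defensive.

Local Open Scope classical_set_scope.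
Local Open Scope card_scope.

(** The reflexive closure of adjacency: continuity is its plain preservation, and for [NP_v] it is a
    componentwise relation. *)
Definition adj_or_eq (X : digital_image) (x y : X) := x = y \/ adj x y.

Lemma adj_or_eq_sym (X : digital_image) (x y : X) :
  adj_or_eq x y -> adj_or_eq y x.
Proof. by case=> [->|xy]; [left | right; rewrite adj_sym]. Qed.

Lemma continuous_adj_or_eq (X Y : digital_image) (f : X -> Y) :
  continuous_map f <-> forall x y, adj_or_eq x y -> adj_or_eq (f x) (f y).
Proof.
split=> fc x y; first by case=> [->|/fc//]; left.
by move=> xy; apply: fc; right.
Qed.

(** Indexing time by all of [nat], with an eventually constant family, removes the length from the
    type of a homotopy, so homotopies of different lengths can be run side by side. *)
Lemma homotopicP (X Y : digital_image) (f g : X -> Y) :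
  homotopic f g <->
  exists H : nat -> X -> Y,
    [/\ H 0 = f, exists m, forall t, m <= t -> H t = g,
        forall t, continuous_map (H t) &
        forall t x, adj_or_eq (H t x) (H t.+1 x)].
Proof.
split=> [[fc gc [m [F [m0 F0m Ft Fx]]]] | [H [H0 [m Hm] Hc Ht]]].
  (* Time is truncated at [m], so the homotopy stays at [g] afterwards. *)
  exists (fun t x => F x (inord (minn t m))); split=> //.
  - apply/funext => x; rewrite /= min0n.
    have -> : inord 0 = ord0 :> 'I_m.+1 by apply/val_inj; rewrite /= inordK.
    by case: (F0m x).
  - exists m => t mt; apply/funext => x; rewrite /= (minn_idPr mt).
    have -> : inord m = ord_max :> 'I_m.+1 by apply/val_inj; rewrite /= inordK.
    by case: (F0m x).
  - move=> t x /=; have [mt|tm] := leqP m t.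
      by left; rewrite (minn_idPr (leqW mt)).
    rewrite (minn_idPl tm); apply: Ft.
    by rewrite /interval_adj !inordK ?eqxx // ltnS ltnW.
split; [by rewrite -H0 | by rewrite -(Hm m) |].
(* The bound [m] may be [0], whereas a homotopy has positive length; at [m.+1] the family still
   equals [g]. *)
exists m.+1, (fun x t => H t x); split=> //.
- by move=> x; rewrite /= H0 Hm.
- move=> x s t /orP[] /eqP <-; first exact: Ht.
  exact/adj_or_eq_sym/Ht.
Qed.

Lemma homotopic_refl (X Y : digital_image) (f : X -> Y) :
  continuous_map f -> homotopic f f.
Proof.
move=> fc; apply/homotopicP; exists (fun _ => f); split=> //; first by exists 0.
by move=> t x; left.
Qed.

Lemma homotopy_equivalent_refl (X : digital_image) : homotopy_equivalent X X.
Proof.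
have idc : continuous_map (@id X) by move=> x y; right.
by exists id, id; split=> //; apply: homotopic_refl.
Qed.

Section Product.
Variable v : nat.
Implicit Types X Y Z : 'I_v -> digital_image.

Lemma prod_of_subproof X (c : forall i, X i) :
  (\mxrow_i val (c i))%R \in @prod_points v X.
Proof. by apply/mem_set => i; rewrite mxrowK; apply/set_mem/valP. Qed.

Definition prod_of X (c : forall i, X i) : NP_product X v :=
  exist _ (\mxrow_i val (c i))%R (prod_of_subproof c).

Lemma component_prod_of X (c : forall i, X i) i : component (prod_of c) i = c i.
Proof. by apply/val_inj; rewrite /= mxrowK. Qed.

Lemma component_inj X (x y : NP_product X v) :
  (forall i, component x i = component y i) -> x = y.
Proof.
move=> xy; apply/val_inj; rewrite -[LHS]submxrowK -[RHS]submxrowK.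
by apply: eq_mxrow => i; have [] := congr1 val (xy i).
Qed.

(** With [u = v] the upper bound on the number of adjacent components always holds, as there are
    only [v] indices. *)
Lemma NP_adj_or_eqP X (x y : NP_product X v) :
  adj_or_eq x y <-> forall i, adj_or_eq (component x i) (component y i).
Proof.
split=> [[->|xy] i | xy]; first by left.
  case/and3P: xy => _ _ /forallP/(_ i); rewrite inE.
  case axy: (adj _ _) => /=; first by right.
  by move/eqP; left.
have [->|nxy] := eqVneq x y; first by left.
right; apply/and3P; split=> //; last first.
  by apply/forallP => i; rewrite inE; apply/implyP; case: (xy i) => [->|->].
apply/andP; split; last by rewrite -[leqRHS]card_ord max_card.
rewrite card_gt0.
(* If no component were adjacent, all would be equal, and so would [x] and [y]. *)
apply: contra_neq nxy => A0; apply: component_inj => i.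
by case: (xy i) => // axy; move/setP/(_ i): A0; rewrite !inE axy.
Qed.

Definition prod_map X Y (f : forall i, X i -> Y i)
    (x : NP_product X v) : NP_product Y v :=
  prod_of (fun i => f i (component x i)).

Lemma prod_map_comp X Y Z (f : forall i, X i -> Y i)
    (g : forall i, Y i -> Z i) :
  (fun x => prod_map g (prod_map f x)) = prod_map (fun i x => g i (f i x)).
Proof.
by apply/funext => x; apply: component_inj => i; rewrite !component_prod_of.
Qed.

Lemma prod_map_id X : prod_map (fun i => @id (X i)) = id.
Proof.
by apply/funext => x; apply: component_inj => i; rewrite component_prod_of.
Qed.

Lemma prod_map_continuous X Y (f : forall i, X i -> Y i) :
  (forall i, continuous_map (f i)) -> continuous_map (prod_map f).
Proof.
move=> fc; apply/continuous_adj_or_eq => x y /NP_adj_or_eqP xy.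
apply/NP_adj_or_eqP => i; rewrite !component_prod_of.
by have /continuous_adj_or_eq := fc i; apply.
Qed.

Lemma prod_map_homotopic X Y (f g : forall i, X i -> Y i) :
  (forall i, homotopic (f i) (g i)) -> homotopic (prod_map f) (prod_map g).
Proof.
move=> fg; have /all_sig[H HP] i := cid ((homotopicP _ _).1 (fg i)).
have /all_sig[m Hm] i : {m | forall t, m <= t -> H i t = g i}.
  by apply/cid; case: (HP i).
apply/homotopicP; exists (fun t => prod_map (fun i => H i t)); split.
- by congr prod_map; apply: functional_extensionality_dep => i; case: (HP i).
(* From the largest of the stabilization times on, every factor has reached [g i]. *)
- exists (\max_i m i) => t mt.
  congr prod_map; apply: functional_extensionality_dep => i; apply: Hm.
  exact: leq_trans (leq_bigmax i) mt.
- by move=> t; apply: prod_map_continuous => i; case: (HP i).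
- move=> t x; apply/NP_adj_or_eqP => i; rewrite !component_prod_of.
  by case: (HP i).
Qed.

Lemma NP_product_homotopy_equivalent X Y :
  (forall i, homotopy_equivalent (X i) (Y i)) ->
  homotopy_equivalent (NP_product X v) (NP_product Y v).
Proof.
move=> XY; have /all_sig[f fP] i := cid (XY i).
have /all_sig[g gP] i := cid (fP i).
exists (prod_map f), (prod_map g); split.
- by apply: prod_map_continuous => i; case: (gP i).
- by apply: prod_map_continuous => i; case: (gP i).
- rewrite prod_map_comp -prod_map_id.
  by apply: prod_map_homotopic => i; case: (gP i).
- rewrite prod_map_comp -prod_map_id.
  by apply: prod_map_homotopic => i; case: (gP i).
Qed.

Lemma card_NP_product X (n : 'I_v -> nat) :
  (forall i, points (X i) #= `I_(n i)) ->
  points (NP_product X v) #= `I_(\prod_i n i).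
Proof.
move=> Xn.
have /all_tag[e e'P] i :
    {e : X i -> 'I_(n i) & {e' | cancel e e' & cancel e' e}}.
  have /card_bijP/cid[e eb] : points (X i) #= [set: 'I_(n i)].
    by rewrite -(card_eqr card_II).
  have /cid2[e' eK e'K] : exists2 e', cancel e e' & cancel e' e.
    by case: eb => g; exists g.
  (* The bijection lands in the subtype of the full set; [val] and [to_setT] remove and restore this
     wrapper. *)
  exists (fun x => val (e x)), (fun k => e' (to_setT k)) => [x|k] /=.
    by rewrite -[RHS]eK; congr e'; apply/val_inj.
  by rewrite e'K.
have /all_sig2[e' eK e'K] i := e'P i.
(* Points are encoded by the families of the numbers of their components, and such families are
   counted by the product. *)
have -> : \prod_i n i = #|{dffun forall i, 'I_(n i)}|.
  rewrite card_dep_ffun foldrE big_image /=.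
  by apply: eq_bigr => i _; rewrite card_ord.
rewrite (card_eqr card_II); apply/card_bijP.
pose f (x : NP_product X v) : {dffun forall i, 'I_(n i)} :=
  [ffun i => e i (component x i)].
pose g (c : {dffun forall i, 'I_(n i)}) : NP_product X v :=
  prod_of (fun i => e' i (c i)).
have fK : cancel f g.
  by move=> x; apply: component_inj => i; rewrite component_prod_of ffunE eK.
have gK : cancel g f.
  by move=> c; apply/ffunP => i; rewrite ffunE component_prod_of e'K.
exists (fun x => to_setT (enum_rank (f x))), (fun k => g (enum_val (val k))).
  by move=> x /=; rewrite enum_rankK fK.
by move=> k; apply/val_inj; rewrite /= gK enum_valK.
Qed.

End Product.

Lemma fewer_points_ltn (X Y : digital_image) (m n : nat) :
  points Y #= `I_m -> points X #= `I_n -> fewer_points Y X = (m < n).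
Proof.
move=> Ym Xn; rewrite /fewer_points.
rewrite (card_le_eql Ym) (card_le_eqr Xn) (card_le_eql Xn) (card_le_eqr Ym).
by rewrite !card_le_II -ltnNge andbC; case: ltngtP.
Qed.

Theorem theorem3p2 (v : nat) (X : 'I_v -> digital_image)
  (X_finite : forall i : 'I_v, finite_set (points (X i)))
  (X_nonempty : forall i : 'I_v, nonempty (points (X i)))
  (j : 'I_v) (Xj_reducible : reducible (X j)) :
  reducible (NP_product X v).
Proof.
have /all_sig[n nP] i := cid ((finite_setP _).1 (X_finite i)).
have Xn := card_NP_product nP.
split; first by apply/finite_setP; eexists; exact: Xn.
case: Xj_reducible => _ [Y [XY ltYX]].
(* [Y] is finite because it injects into the finite [X j]. *)
have /finite_setP[m mP] : finite_set (points Y).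
  by case/andP: ltYX => /card_le_finite YX _; apply: YX.
pose Z i := if i == j then Y else X i.
pose k i := if i == j then m else n i.
have Zk i : points (Z i) #= `I_(k i) by rewrite /Z /k; case: eqVneq => [_|_].
exists (NP_product Z v); split.
  apply: NP_product_homotopy_equivalent => i; rewrite /Z.
  by case: eqVneq => [->|_] //; apply: homotopy_equivalent_refl.
rewrite (fewer_points_ltn (card_NP_product Zk) Xn).
(* Away from [j] both products have the same factors, so [m < n j] decides once this common part is
   positive, which nonemptiness gives. *)
rewrite (bigD1 j) //= [ltnRHS](bigD1 j) //= /k eqxx.
rewrite (eq_bigr n) => [|i /negPf->//].
rewrite ltn_pmul2r -?(fewer_points_ltn mP (nP j)) //.
apply: prodn_gt0 => i; rewrite lt0n; apply/eqP => n0.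
have [x Xx] := X_nonempty i.
by move: (nP i); rewrite n0 II0 card_eq0 => /eqP X0; rewrite X0 in Xx.
Qed.
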